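(* Let $n\in\mathbb N$, let $r>0$, and let $f$ be an $n$-th tropical meromorphic function on $[-r,r]$. Let $x\in(-r,r)$, let $\{x_i\}$ be the set of all singularities of $f$ in $(-r,r)$, and denote by $y_{i,j}=x_i$ and $z_{i,j}=x_i$ the $j$-th roots and the $j$-th poles of $f$ respectively. Then $$\begin{aligned} f(x)={}&\frac12[f(r)+f(-r)]+\frac{D_n(r,x)}{2B_n(r,x)}[f(r)-f(-r)]\\ &-\sum_{j=1}^{n}\left(\sum_{x_i\in F_1\cup F_2\cup F_3\cup F_6\cup F_8}+(-1)^{j+1}\sum_{x_i\in F_4\cup F_5\cup F_7\cup F_9}\right)\omega_f^{(j)}(x_i)\,E^{j}(r,x,x_i)\,\frac{B_{n-j}(r,x)}{2B_n(r,x)}\\ &-\sum_{j=1}^{n}\left(-\sum_{x_i\in F_1}+\sum_{x_i\in F_2\cup F_6\cup F_8}+(-1)^{j}\sum_{x_i\in F_4\cup F_7}+(-1)^{j+1}\sum_{x_i\in F_5\cup F_9}\right)\omega_f^{(j)}(x_i)\,E^{j}(r,x,x_i)\,\frac{D_{n-j}(r,x)}{2B_n(r,x)}\\ &-\left(\frac{(r+x)^n}{2B_n(r,x)}\big(f_{x^-}(r)-f(x)\big)+\frac{(r-x)^n}{2B_n(r,x)}\big(f_{x^-}(-r)-f(x)\big)\right)\\ &-\operatorname{sgn}(x^-)\frac{(r-|x|)^n}{2B_n(r,x)}\big(f_{0^-}(r)+f_{0^-}(-r)-2f(0)\big). \end{aligned}$$ In particular, when $x=0$, $$f(0)=\frac12[f(r)+f(-r)]-\frac12\sum_{j=1}^{n}\sum_{|y_{i,j}|<r}|\omega_f^{(j)}(y_{i,j})|(r-|y_{i,j}|)^j+\frac12\sum_{j=1}^{n}\sum_{|z_{i,j}|<r}|\omega_f^{(j)}(z_{i,j})|(r-|z_{i,j}|)^j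 .$$
   Context: $\mathbb N=\{1,2,\dots\}$. For $n\in\mathbb N$, an $n$-th tropical meromorphic function on $\mathbb R$ is a continuous function $f:\mathbb R\to\mathbb R$ for which there is an increasing sequence of breakpoints $\{x_i\}$ without finite accumulation point such that on each interval $[x_{i-1},x_i]$ $f$ equals a polynomial of degree $n_i$, with $\sup_i n_i=n$ (in particular $f$ is non-constant); on $[-r,r]$ the definition is the same with $\mathbb R$ replaced by $[-r,r]$. Sign convention: $\operatorname{sgn}(x^{\pm})=\operatorname{sgn}(x)$ for $x\ne0$, and $\operatorname{sgn}(0^{\pm})=\pm1$; $\operatorname{sgn}^{k}$ is the $k$-th power of $\operatorname{sgn}$. $f^{(j)}(x^{\pm})$ are the one-sided $j$-th derivatives. For $1\le j\le n$, $$\omega_f^{(j)}(x)=\frac{\operatorname{sgn}^{j+1}(x^+)f^{(j)}(x^+)-\operatorname{sgn}^{j+1}(x^-)f^{(j)}(x^-)}{j!}.$$ A point $x$ is a $j$-th root of $f$ if $\omega_f^{(j)}(x)>0$ and a $j$-th pole if $\omega_f^{(j)}(x)<0$, with multiplicity $|\omega_f^{(j)}(x)|$. All roots and poles of all orders $j=1,\dots,n$ are called singularities of $f$. For a point $x_0$, $f_{x_0^+}$ and $f_{x_0^-}$ denote the polynomials (viewed as functions on all of $\mathbb R$) with which $f$ coincides immediately to the right and immediately to the left of $x_0$, respectively. For $k\in\mathbb N\cup\{0\}$, $B_k(r,x)=\frac{(r+x)^k+(r-x)^k}{2}$ and $D_k(r,x)=\frac{(r+x)^k-(r-x)^k}{2}$.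 For $x,x_i\in(-r,r)$, $E(r,x,x_i)=r^2-|x-x_i|r-xx_i$, and $E^j$ is its $j$-th power. The sets $F_l=F_l(r,x)\subset(-r,r)$, some possibly empty, are: $F_1=\{y:-r<y<\min\{0,x\}\}$, $F_2=\{y:\max\{0,x\}<y<r\}$, $F_3=\{y:y=x=0\}$, $F_4=\{y:0<y<x\}$, $F_5=\{y:x<y<0\}$, $F_6=\{y:x<y=0\}$, $F_7=\{y:y=0<x\}$, $F_8=\{y:0<y=x\}$, $F_9=\{y:y=x<0\}$. A sum ''$\sum_{x_i\in F}$'' runs over the singularities $x_i$ lying in $F$. *)

(* Defs.v *)
From HB Require Import structures.
From mathcomp Require Import all_boot all_order all_algebra.
From mathcomp Require Import all_classical all_reals all_analysis.

Set Implicit Arguments.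
Unset Strict Implicit.
Unset Printing Implicit Defensive.

Import Order.TTheory GRing.Theory Num.Theory.
Import numFieldNormedType.Exports.

Local Open Scope classical_set_scope.
Local Open Scope ring_scope.

(* A set of breakpoints in the compact interval [-r, r] has no accumulation
   point iff it is finite, so the breakpoint sequence is b 0 < ... < b m with
   the endpoints of the interval included. The value of f outside [-r, r] is
   irrelevant. (size p).-1 is the degree of p. *)
Definition tropical_meromorphic (R : realType) (n : nat) (r : R) (f : R -> R)
    : Prop :=
  {within `[- r, r], continuous f} /\
  exists (m : nat) (b : nat -> R) (p : nat -> {poly R}),
    [/\ b 0%N = - r,
        b m = r,
        (forall i, (i < m)%N -> b i < b i.+1),
        (forall i, (i < m)%N ->
           forall y, b i <= y <= b i.+1 -> f y = (p i).[y]) &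
        (\max_(i < m) (size (p i)).-1)%N = n].

Definition sgn_right (R : realType) (x : R) : R :=
  if x == 0 then 1 else Num.sg x.

Definition sgn_left (R : realType) (x : R) : R :=
  if x == 0 then -1 else Num.sg x.

Definition right_derive (R : realType) (f : R -> R) (x : R) : R :=
  lim ((f (x + h) - f x) / h @[h --> 0^'+]).

Definition left_derive (R : realType) (f : R -> R) (x : R) : R :=
  lim ((f (x + h) - f x) / h @[h --> 0^'-]).

Definition right_deriven (R : realType) (j : nat) (f : R -> R) : R -> R :=
  iter j (@right_derive R) f.

Definition left_deriven (R : realType) (j : nat) (f : R -> R) : R -> R :=
  iter j (@left_derive R) f.

Definition omega (R : realType) (f : R -> R) (j : nat) (x : R) : R :=
  (sgn_right x ^+ j.+1 * right_deriven j f x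
   - sgn_left x ^+ j.+1 * left_deriven j f x) / (j`!)%:R.

Definition is_root (R : realType) (f : R -> R) (j : nat) (x : R) : Prop :=
  0 < omega f j x.

Definition is_pole (R : realType) (f : R -> R) (j : nat) (x : R) : Prop :=
  omega f j x < 0.

Definition singularities (R : realType) (n : nat) (r : R) (f : R -> R)
    : set R :=
  [set y | - r < y < r /\
           exists j, (1 <= j <= n)%N /\ (is_root f j y \/ is_pole f j y)].

(* Two polynomials that agree near x on one side are equal, so the choice made
   by xget is unambiguous whenever such a polynomial exists. *)
Definition left_poly (R : realType) (f : R -> R) (x : R) : {poly R} :=
  xget 0 [set p : {poly R} | \forall y \near x^'-, f y = p.[y]].

Definition B (R : realType) (k : nat) (r x : R) : R :=
  ((r + x) ^+ k + (r - x) ^+ k) / 2.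

Definition D (R : realType) (k : nat) (r x : R) : R :=
  ((r + x) ^+ k - (r - x) ^+ k) / 2.

Definition E (R : realType) (r x y : R) : R :=
  r ^+ 2 - `|x - y| * r - x * y.

Definition F1 (R : realType) (r x : R) : set R :=
  [set y | - r < y < Num.min 0 x].

Definition F2 (R : realType) (r x : R) : set R :=
  [set y | Num.max 0 x < y < r].

Definition F3 (R : realType) (x : R) : set R :=
  [set y | y = x /\ x = 0].

Definition F4 (R : realType) (x : R) : set R :=
  [set y | 0 < y < x].

Definition F5 (R : realType) (x : R) : set R :=
  [set y | x < y < 0].

Definition F6 (R : realType) (x : R) : set R :=
  [set y | x < y /\ y = 0].

Definition F7 (R : realType) (x : R) : set R :=
  [set y | y = 0 /\ 0 < x].

Definition F8 (R : realType) (x : R) : set R :=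
  [set y | 0 < y /\ y = x].

Definition F9 (R : realType) (x : R) : set R :=
  [set y | y = x /\ x < 0].

(* \sum_(y \in A) is 0 when infinitely many terms are nonzero; this does not
   happen here, as the singularities of a tropical meromorphic f are among its
   breakpoints and 0. *)
Definition singsum (R : realType) (n : nat) (r : R) (f : R -> R) (F : set R)
    (g : R -> R) : R :=
  \sum_(y \in singularities n r f `&` F) g y.

(* Main.v *)
(* A piecewise polynomial is recovered from the polynomial L to the left of x by
   adding the jumps: f(r) = L(r) + sum of J_y(r) over y >= x, and
   f(-r) = L(-r) - sum of J_y(-r) over y < x, where J_y is the difference of the
   two polynomials meeting at y. Take the combination with weights (r + x)^n and
   (r - x)^n, and expand each J_y by Taylor's formula at y. Since E(r, x, y)
   factors as (r + x)(r - y) or (r - x)(r + y), and B_k + D_k = (r + x)^k,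
   B_k - D_k = (r - x)^k, each Taylor term is the summand of the formula, except
   at y = 0: there the sign convention turns the jump of the j-th derivatives
   into f^(j)(0+) + (-1)^j f^(j)(0-), and the discrepancy is the last term. *)
Require Import Defs.
From HB Require Import structures.
From mathcomp Require Import all_boot all_order all_algebra.
From mathcomp Require Import all_classical all_reals all_analysis.
From mathcomp Require Import ring lra.

Set Implicit Arguments.
Unset Strict Implicit.
Unset Printing Implicit Defensive.

Import Order.TTheory GRing.Theory Num.Theory.
Import numFieldNormedType.Exports.

Local Open Scope classical_set_scope.
Local Open Scope ring_scope.

(** * One-sided neighbourhoods and iterated one-sided derivatives *)

Lemma near_at_rightP (R : realType) (P : R -> Prop) (x : R) :
  (\forall z \near x^'+, P z) <-> exists2 e, x < e & forall z, x < z < e -> P z.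
Proof.
split=> [|[e xe eP]].
  rewrite near_withinE => /nbhs_ballP[e /= e0 eP].
  exists (x + e); first by rewrite ltrDl.
  move=> z /andP[xz ze]; apply: eP => //=.
  by rewrite /ball/= ltr0_norm ?subr_lt0// opprB ltrBlDl.
near=> z; apply: eP; apply/andP; split.
  by near: z; exact: nbhs_right_gt.
by near: z; exact: nbhs_right_lt.
Unshelve. all: by end_near. Qed.

Lemma near_at_leftP (R : realType) (P : R -> Prop) (x : R) :
  (\forall z \near x^'-, P z) <-> exists2 e, e < x & forall z, e < z < x -> P z.
Proof.
split=> [|[e xe eP]].
  rewrite near_withinE => /nbhs_ballP[e /= e0 eP].
  exists (x - e); first by rewrite ltrBlDl ltrDr.
  move=> z /andP[xz ze]; apply: eP => //=.
  by rewrite /ball/= gtr0_norm ?subr_gt0// ltrBlDl addrC -ltrBlDl.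
near=> z; apply: eP; apply/andP; split.
  by near: z; exact: nbhs_left_gt.
by near: z; exact: nbhs_left_lt.
Unshelve. all: by end_near. Qed.

Lemma horner_slope (R : realType) (p : {poly R}) (x : R) :
  (p.[x + h] - p.[x]) / h @[h --> 0^'] --> p^`().[x].
Proof.
have := is_derive_poly p x => -[dp dpE].
rewrite -dpE.
have := dp; rewrite /derivable => /cvg_ex [l hl].
rewrite /derive (cvg_lim _ hl)//; move: hl; apply: cvg_trans.
apply: near_eq_cvg; near=> h => /=.
rewrite [h%:A]mulr1 (addrC h) [LHS]mulrC //.
Unshelve. all: by end_near. Qed.

Lemma right_deriven_near_poly (R : realType) (f : R -> R) (p : {poly R})
    (x : R) (j : nat) :
  (\forall z \near x^'+, f z = p.[z]) -> f x = p.[x] ->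
  right_deriven j f x = p^`(j).[x].
Proof.
move=> /near_at_rightP[e xe fp] fx.
(* Each further right derivative at [x] uses the previous one at [x] and just to its right, so the
   induction runs over the half-open interval. *)
suff H z : x <= z < e -> right_deriven j f z = p^`(j).[z] by rewrite H ?lexx.
elim: j z => [|j IH] z /andP[xz ze].
  by move: xz; rewrite le_eqVlt => /predU1P[<-//|xz]; apply: fp; rewrite xz.
rewrite derivnS /right_deriven iterS -/(right_deriven j f) /right_derive.
apply: cvg_lim => //.
apply: cvg_trans (cvg_dnbhs_at_right (@horner_slope R (p^`(j)) z)).
apply: near_eq_cvg; near=> h.
have h0 : 0 < h by near: h; exact: nbhs_right_gt.
rewrite !IH ?xz ?ze// -?ltrBrDl.
by rewrite ler_wpDr// ?ltW//=; near: h; apply: nbhs_right_lt; rewrite subr_gt0.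
Unshelve. all: by end_near. Qed.

Lemma left_deriven_near_poly (R : realType) (f : R -> R) (p : {poly R})
    (x : R) (j : nat) :
  (\forall z \near x^'-, f z = p.[z]) -> f x = p.[x] ->
  left_deriven j f x = p^`(j).[x].
Proof.
move=> /near_at_leftP[e xe fp] fx.
suff H z : e < z <= x -> left_deriven j f z = p^`(j).[z] by rewrite H ?lexx ?xe.
elim: j z => [|j IH] z /andP[ez zx].
  by move: zx; rewrite le_eqVlt => /predU1P[->//|zx]; apply: fp; rewrite ez.
rewrite derivnS /left_deriven iterS -/(left_deriven j f) /left_derive.
apply: cvg_lim => //.
apply: cvg_trans (cvg_dnbhs_at_left (@horner_slope R (p^`(j)) z)).
apply: near_eq_cvg; near=> h.
have h0 : h < 0 by near: h; exact: nbhs_left_lt.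
rewrite !IH ?zx ?ez// -?ltrBlDl.
by rewrite ler_wnDr// ?ltW//= ?andbT; near: h; apply: nbhs_left_gt;
  rewrite subr_lt0.
Unshelve. all: by end_near. Qed.

(** * The polynomials adjacent to a point *)

Lemma near_left_poly_inj (R : realType) (p q : {poly R}) (x : R) :
  (\forall z \near x^'-, p.[z] = q.[z]) -> p = q.
Proof.
move=> /near_at_leftP[e ex pq].
apply/eqP; rewrite -subr_eq0; apply/negPn/negP => d0.
(* These are distinct points of the open interval [(e, x)], as many as the size of [p - q], hence
   too many roots. A denominator [k.+1] would give the excluded point [e] at [k = 0]. *)
pose u k := x - (x - e) / k.+2%:R.
have xe0 : 0 < x - e by rewrite subr_gt0.
have := max_poly_roots d0 (rs := [seq u k | k <- iota 0 (size (p - q))]).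
rewrite size_map size_iota ltnn => H; apply/notF/H.
  apply/allP => _ /mapP[k _ ->]; rewrite rootE hornerD hornerN subr_eq0.
  apply/eqP/pq; rewrite /u ltrBlDr ltrDl divr_gt0// andbT ltrBrDr -ltrBrDl.
  by rewrite ltr_pdivrMr// ltr_pMr// ltr1n.
rewrite map_inj_uniq ?iota_uniq// => i k /addrI/oppr_inj/mulfI.
by rewrite gt_eqF// => /(_ isT)/invr_inj/eqP; rewrite eqr_nat => /eqP[].
Qed.

Lemma left_polyE (R : realType) (f : R -> R) (p : {poly R}) (x : R) :
  (\forall z \near x^'-, f z = p.[z]) -> left_poly f x = p.
Proof.
move=> fp; apply: xget_unique => // q fq; apply: (@near_left_poly_inj _ _ _ x).
by apply: filterS2 fq fp => z <- <-.
Qed.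

Definition right_poly (R : realType) (f : R -> R) (x : R) : {poly R} :=
  xget 0 [set p : {poly R} | \forall y \near x^'+, f y = p.[y]].

Lemma near_right_poly_inj (R : realType) (p q : {poly R}) (x : R) :
  (\forall z \near x^'+, p.[z] = q.[z]) -> p = q.
Proof.
(* The interval [(x, e)] is also a left neighbourhood of [e], which reduces the claim to the
   left-sided one. *)
move=> /near_at_rightP[e ex pq]; apply: (@near_left_poly_inj _ _ _ e).
by apply/near_at_leftP; exists x.
Qed.

Lemma right_polyE (R : realType) (f : R -> R) (p : {poly R}) (x : R) :
  (\forall z \near x^'+, f z = p.[z]) -> right_poly f x = p.
Proof.
move=> fp; apply: xget_unique => // q fq; apply: (@near_right_poly_inj _ _ _ x).
by apply: filterS2 fq fp => z <- <-.
Qed.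

Definition jump (R : realType) (f : R -> R) (x : R) : {poly R} :=
  right_poly f x - left_poly f x.

(** * Breakpoints and telescoping jumps *)

(** Closing the pieces on the right assigns a breakpoint to the piece ending there, the one that
    [left_poly] sees. *)
Lemma locate_left_open (R : realType) (b : nat -> R) (m : nat) (x : R) :
  b 0%N < x <= b m -> exists2 k, (k < m)%N & b k < x <= b k.+1.
Proof.
elim: m => [|m IH /andP[bx xm]]; first by rewrite lt_le_asym.
have [xm'|mx] := leP x (b m); last by exists m; rewrite ?mx.
by have [|k km kx] := IH; [rewrite bx|exists k => //; exact: ltnW].
Qed.

Lemma locate_right_open (R : realType) (b : nat -> R) (m : nat) (x : R) :
  b 0%N <= x < b m -> exists2 k, (k < m)%N & b k <= x < b k.+1.
Proof.
elim: m => [|m IH /andP[bx xm]]; first by rewrite le_lt_asym.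
have [mx|xm'] := leP (b m) x; first by exists m; rewrite ?mx.
by have [|k km kx] := IH; [rewrite bx|exists k => //; exact: ltnW].
Qed.

Lemma incr_prefix_lt (R : realType) (b : nat -> R) (m : nat) :
  (forall i, (i < m)%N -> b i < b i.+1) ->
  forall i j, (i < j)%N -> (j <= m)%N -> b i < b j.
Proof.
move=> b_incr i; elim=> // j IH; rewrite ltnS leq_eqVlt => /predU1P[->|ij] jm.
  exact: b_incr.
exact: lt_trans (IH ij (ltnW jm)) (b_incr _ jm).
Qed.

Lemma left_poly_piece (R : realType) (f : R -> R) (p : {poly R}) (u v x : R) :
  (forall y, u <= y <= v -> f y = p.[y]) -> u < x <= v -> left_poly f x = p.
Proof.
move=> fp /andP[ux xv]; apply/left_polyE/near_at_leftP; exists u => // z.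
by move=> /andP[uz zx]; rewrite fp// ltW//= (le_trans (ltW zx)).
Qed.

Lemma right_poly_piece (R : realType) (f : R -> R) (p : {poly R}) (u v x : R) :
  (forall y, u <= y <= v -> f y = p.[y]) -> u <= x < v -> right_poly f x = p.
Proof.
move=> fp /andP[ux xv]; apply/right_polyE/near_at_rightP; exists v => // z.
by move=> /andP[uz zx]; rewrite fp// (ltW zx) (le_trans ux (ltW uz)).
Qed.

Lemma left_polyP (R : realType) (n : nat) (r : R) (f : R -> R) (x : R) :
  tropical_meromorphic n r f -> - r < x < r ->
  [/\ (size (left_poly f x) <= n.+1)%N,
      \forall z \near x^'-, f z = (left_poly f x).[z]
    & f x = (left_poly f x).[x]].
Proof.
move=> [_ [m [b [p [b0 bm b_incr fp <-]]]]] /andP[rx xr].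
have [|k km /andP[kx xk]] := @locate_left_open R b m x.
  by rewrite b0 bm rx ltW.
rewrite (left_poly_piece (fp _ km)) ?kx//; split.
- rewrite (leq_trans (leqSpred _))// ltnS.
  exact: (leq_bigmax (Ordinal km) (F := fun i : 'I_m => (size (p i)).-1)).
- apply/near_at_leftP; exists (b k) => // z /andP[kz zx].
  by rewrite (fp _ km)// ltW//= (le_trans (ltW zx)).
- by rewrite -(fp _ km)// ltW.
Qed.

Lemma right_polyP (R : realType) (n : nat) (r : R) (f : R -> R) (x : R) :
  tropical_meromorphic n r f -> - r < x < r ->
  [/\ (size (right_poly f x) <= n.+1)%N,
      \forall z \near x^'+, f z = (right_poly f x).[z]
    & f x = (right_poly f x).[x]].
Proof.
move=> [_ [m [b [p [b0 bm b_incr fp <-]]]]] /andP[rx xr].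
have [|k km /andP[kx xk]] := @locate_right_open R b m x.
  by rewrite b0 bm xr ltW.
rewrite (right_poly_piece (fp _ km)) ?kx//; split.
- rewrite (leq_trans (leqSpred _))// ltnS.
  exact: (leq_bigmax (Ordinal km) (F := fun i : 'I_m => (size (p i)).-1)).
- apply/near_at_rightP; exists (b k.+1) => // z /andP[kz zx].
  by rewrite (fp _ km)// (ltW zx) (le_trans kx (ltW kz)).
- by rewrite -(fp _ km)// kx ltW.
Qed.

(** The jump at a breakpoint is the difference of consecutive pieces, so the jumps between the piece
    left of [x] and an outermost piece telescope. *)
Lemma tropical_jumps (R : realType) (n : nat) (r : R) (f : R -> R) :
  0 < r -> tropical_meromorphic n r f ->
  exists s : seq R,
    [/\ uniq s, forall y, y \in s -> - r < y < r,
        forall y, - r < y < r -> y \notin s -> jump f y = 0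
      & forall x, - r < x < r ->
          f r = (left_poly f x).[r] + \sum_(y <- s | x <= y) (jump f y).[r] /\
          f (- r) =
            (left_poly f x).[- r] - \sum_(y <- s | y < x) (jump f y).[- r]].
Proof.
move=> r0 [_ [m [b [p [b0 bm b_incr fp _]]]]].
have b_lt := incr_prefix_lt b_incr.
have m0 : (0 < m)%N.
  rewrite lt0n; apply/eqP => m0; have := r0.
  by rewrite -{1}bm m0 b0 oppr_gt0 ltNge ltW.
have leftb i : (0 < i <= m)%N -> left_poly f (b i) = p i.-1.
  case: i => // i /= im; apply: left_poly_piece (fp _ im) _.
  by rewrite b_incr ?lexx.
have rightb i : (i < m)%N -> right_poly f (b i) = p i.
  by move=> im; apply: right_poly_piece (fp _ im) _; rewrite b_incr ?lexx.
(* Indices run from 1 to [m - 1]: the endpoints [b 0] and [b m] are left out. *)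
exists [seq b i | i <- index_iota 1 m]; split.
- rewrite map_inj_in_uniq ?iota_uniq// => i j; rewrite !mem_index_iota.
  move=> /andP[_ im] /andP[_ jm] bij; have [ij|ji|//] := ltngtP i j.
    by have := b_lt _ _ ij (ltnW jm); rewrite bij ltxx.
  by have := b_lt _ _ ji (ltnW im); rewrite bij ltxx.
- move=> _ /mapP[i + ->]; rewrite mem_index_iota => /andP[i0 im].
  by rewrite -b0 -bm; apply/andP; split; apply: b_lt => //; exact: ltnW.
- move=> y /andP[ry yr] ys.
  have [|k km /andP[ky yk]] := @locate_right_open R b m y.
    by rewrite b0 bm yr ltW.
  (* If [y = b k], then [k = 0] would give [y = - r], and [k > 0] would put [y] in the list. So [y]
     is interior to a piece, and both adjacent polynomials are [p k]. *)
  have {}ky : b k < y.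
    rewrite lt_neqAle ky andbT; apply: contra ys => /eqP ky'.
    case: k km ky ky' yk => [_ _ yr' _|k km _ <- _].
      by move: ry; rewrite -yr' b0 ltxx.
    by rewrite map_f// mem_index_iota.
  by rewrite /jump (left_poly_piece (fp _ km)) ?(right_poly_piece (fp _ km))
    ?subrr ?ky ?yk ?ltW.
move=> x /andP[rx xr].
have [|k km /andP[kx xk]] := @locate_left_open R b m x.
  by rewrite b0 bm rx ltW.
rewrite (left_poly_piece (fp _ km)) ?kx//.
(* Since [b k < x <= b k.+1], comparison with [x] becomes comparison of indices with [k], and the
   filtered sums become index ranges. *)
have bi_ge i : (i <= m)%N -> (x <= b i) = (k < i)%N.
  move=> im; apply/idP/idP => [xi|]; last first.
    rewrite leq_eqVlt => /predU1P[<-//|ki].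
    exact/ltW/(le_lt_trans xk)/b_lt.
  rewrite ltnNge; apply/negP; rewrite leq_eqVlt => /predU1P[ik|ik].
    by move: xi; rewrite ik leNgt kx.
  by move: (le_lt_trans xi (b_lt _ _ ik (ltnW km))); rewrite ltNge ltW.
have fr : f r = (p m.-1).[r].
  have m1 : (m.-1 < m)%N by rewrite prednK.
  by apply: (fp _ m1); rewrite prednK// bm lexx andbT -bm; apply/ltW/b_lt.
have fNr : f (- r) = (p 0%N).[- r].
  by apply: (fp _ m0); rewrite -b0 lexx/=; apply/ltW/b_incr.
have jumpE i t : (i.+1 < m)%N ->
    (jump f (b i.+1)).[t] = (p i.+1).[t] - (p i).[t].
  by move=> im; rewrite /jump rightb// leftb ?hornerD ?hornerN//=; exact: ltnW.
have sum_jump i j t : (i <= j < m)%N ->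
    \sum_(i.+1 <= l < j.+1) (jump f (b l)).[t] = (p j).[t] - (p i).[t].
  move=> /andP[ij jm]; rewrite big_add1 /=.
  rewrite -(telescope_sumr (fun l => (p l).[t]) ij).
  by apply: eq_big_nat => l /andP[_ lj]; rewrite jumpE// (leq_ltn_trans lj).
have sum_ge (F : nat -> R) :
    \sum_(1 <= i < m | x <= b i) F i = \sum_(k.+1 <= i < m) F i.
  rewrite (@big_cat_nat _ _ _ k.+1 1 m)//= big_nat_cond big_pred0 ?add0r.
    rewrite big_nat_cond [RHS]big_nat; apply: eq_bigl => i.
    case: (ltnP k i) => //= ki; case: (ltnP i m) => //= im.
    by rewrite (bi_ge _ (ltnW im)) ki.
  move=> i; apply/negP => /andP[/andP[_ ik]].
  by rewrite (bi_ge _ (ltnW (leq_trans ik km))) ltnNge -ltnS ik.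
have sum_lt (F : nat -> R) :
    \sum_(1 <= i < m | b i < x) F i = \sum_(1 <= i < k.+1) F i.
  rewrite (@big_cat_nat _ _ _ k.+1 1 m)//= addrC big_nat_cond big_pred0 ?add0r.
    rewrite big_nat_cond [RHS]big_nat; apply: eq_bigl => i.
    case: (ltnP 0 i) => //= i0; case: (ltnP i k.+1) => //= ik.
    by rewrite ltNge (bi_ge _ (ltnW (leq_trans ik km))) -leqNgt -ltnS ik.
  move=> i; apply/negP => /andP[/andP[ki im]].
  by rewrite ltNge (bi_ge _ (ltnW im)) ki.
rewrite fr fNr !big_map sum_ge sum_lt; split.
  have := sum_jump k m.-1 r; rewrite !prednK// -ltnS prednK// km leqnn => -> //.
  by rewrite addrC subrK.
by rewrite sum_jump// opprB addrC subrK.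
Qed.

(** The point 0 can be a singularity without being a breakpoint: where [f] is smooth, the sign
    convention still leaves twice the even Taylor coefficients. Adding 0 to the list costs nothing,
    since its jump is then zero. *)
Lemma tropical_jumps0 (R : realType) (n : nat) (r : R) (f : R -> R) :
  0 < r -> tropical_meromorphic n r f ->
  exists s : seq R,
    [/\ uniq s, 0 \in s, forall y, y \in s -> - r < y < r,
        forall y, - r < y < r -> y \notin s -> jump f y = 0
      & forall x, - r < x < r ->
          f r = (left_poly f x).[r] + \sum_(y <- s | x <= y) (jump f y).[r] /\
          f (- r) =
            (left_poly f x).[- r] - \sum_(y <- s | y < x) (jump f y).[- r]].
Proof.
move=> r0 /(tropical_jumps r0) [s [us sr s0 fs]].
have [s_0|s_0] := boolP (0 \in s); first by exists s.
have r_0 : - r < 0 < r by rewrite oppr_lt0 r0.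
have j0 := s0 _ r_0 s_0.
exists (0 :: s); split; rewrite /= ?s_0 ?mem_head//.
- by move=> y; rewrite inE => /predU1P[->//|/sr].
- by move=> y ry; rewrite inE negb_or => /andP[_]; exact: s0.
move=> x xr; rewrite !big_cons j0 !horner0 !add0r !if_same.
exact: fs.
Qed.

(** * Taylor expansion of the jumps *)

Lemma horner_taylor (R : realType) (n : nat) (p : {poly R}) (y t : R) :
  (size p <= n.+1)%N ->
  p.[t] = p.[y] + \sum_(1 <= j < n.+1) p^`N(j).[y] * (t - y) ^+ j.
Proof.
move=> pn; rewrite -{1}(subrK y t) addrC (nderiv_taylor_wide _ pn); last first.
  exact: mulrC.
by rewrite big_ord_recl/= nderivn0 expr0 mulr1 big_add1 big_mkord.
Qed.

Lemma omega_nderivn (R : realType) (n : nat) (r : R) (f : R -> R) (j : nat)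
    (y : R) :
  tropical_meromorphic n r f -> - r < y < r ->
  omega f j y = sgn_right y ^+ j.+1 * (right_poly f y)^`N(j).[y]
                - sgn_left y ^+ j.+1 * (left_poly f y)^`N(j).[y].
Proof.
move=> hf yr.
have [_ near_r fr] := right_polyP hf yr; have [_ near_l fl] := left_polyP hf yr.
rewrite /omega (right_deriven_near_poly j near_r fr).
rewrite (left_deriven_near_poly j near_l fl) !nderivn_def !hornerMn.
by rewrite !mulrnAr -mulrnBl -[X in X / _]mulr_natr mulfK.
Qed.

Lemma sgn_rightX2 (R : realType) (y : R) (j : nat) :
  sgn_right y ^+ j * sgn_right y ^+ j = 1.
Proof.
rewrite -exprD addnn -mul2n exprM /sgn_right.
by case: eqP => [_|/eqP y0]; rewrite ?sqr_sg ?y0/= ?expr1n.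
Qed.

(** For [y] nonzero both signs agree and square to 1, leaving the plain jump. At 0 the left sign
    contributes $-(-1)^{j+1}=(-1)^j$, so the left coefficient is added with this factor instead of
    subtracted; the second term is the difference. *)
Lemma omega_sgn_right (R : realType) (n : nat) (r : R) (f : R -> R) (j : nat)
    (y : R) :
  tropical_meromorphic n r f -> - r < y < r ->
  omega f j y * sgn_right y ^+ j.+1 =
  (jump f y)^`N(j).[y]
  + (y == 0)%:R * ((1 + (-1) ^+ j) * (left_poly f y)^`N(j).[y]).
Proof.
move=> hf yr; rewrite (omega_nderivn j hf yr) /jump linearB hornerD hornerN/=.
rewrite mulrBl mulrAC sgn_rightX2 mul1r -addrA; congr (_ + _).
rewrite mulrAC -exprMn /sgn_right /sgn_left.
have [->|y0] := eqVneq y 0.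
  by rewrite mulr1 mul1r mulrDl mul1r addKr exprS mulN1r mulNr opprK.
by rewrite mul0r addr0 -expr2 sqr_sg y0 expr1n mul1r.
Qed.

(* The singularity y contributes the value at r of the jump polynomial at y when
   y is to the right of x, and minus its value at -r otherwise. *)
Definition far_end (R : realType) (r x y : R) : R := if x <= y then r else - r.

(** The weight of the jump at [y] in $(r+x)^n f(r)+(r-x)^n f(-r)$; the minus sign is there because
    jumps left of [x] are subtracted in $f(-r)$. *)
Definition far_weight (R : realType) (n : nat) (r x y : R) : R :=
  if x <= y then (r + x) ^+ n else - (r - x) ^+ n.

(** The order-[j] contribution of [y] to the formula after clearing the denominator $2B_n(r,x)$. *)
Definition singular_part (R : realType) (n : nat) (r : R) (f : R -> R)
    (x : R) (j : nat) (y : R) : R :=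
  omega f j y * sgn_right y ^+ j.+1
  * (far_weight n r x y * (far_end r x y - y) ^+ j).

Lemma sum_singular_part_at (R : realType) (n : nat) (r : R) (f : R -> R)
    (x y : R) :
  tropical_meromorphic n r f -> - r < y < r ->
  \sum_(1 <= j < n.+1) singular_part n r f x j y =
  far_weight n r x y * (jump f y).[far_end r x y]
  + (y == 0)%:R * (far_weight n r x 0
      * ((left_poly f 0).[r] + (left_poly f 0).[- r] - 2 * f 0)).
Proof.
move=> hf yr.
have [rs _ fr] := right_polyP hf yr; have [ls _ fl] := left_polyP hf yr.
have js : (size (jump f y) <= n.+1)%N.
  by rewrite (leq_trans (size_polyD _ _))// size_polyN geq_max rs.
(* Both adjacent polynomials take the value [f y] at [y], so the constant Taylor term of the jump
   vanishes. *)
rewrite (horner_taylor y _ js) {1}/jump hornerD hornerN -fr -fl subrr add0r.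
have [y0|y0] := eqVneq y 0; last first.
  rewrite mul0r addr0 mulr_sumr; apply: eq_bigr => j _.
  rewrite /singular_part (omega_sgn_right j hf yr) (negbTE y0).
  by rewrite mul0r addr0 mulrCA.
subst y.
(* Adding the expansions at [r] and [- r] doubles the even terms and cancels the odd ones, so the
   result is the same for either far end. *)
have -> : (left_poly f 0).[r] + (left_poly f 0).[- r] - 2 * f 0 =
    \sum_(1 <= j < n.+1)
       (1 + (-1) ^+ j) * (left_poly f 0)^`N(j).[0] * (far_end r x 0 - 0) ^+ j.
  rewrite (horner_taylor 0 r ls) (horner_taylor 0 (- r) ls) -fl.
  have cancel2 (a b c : R) : a + b + (a + c) - 2 * a = b + c by ring.
  rewrite cancel2.
  rewrite -big_split; apply: eq_bigr => j _ /=.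
  rewrite -mulrDr mulrAC mulrC; congr (_ * _).
  rewrite !subr0 /far_end; case: ifP => _;
    rewrite mulrDl mul1r -exprMn mulN1r//.
  by rewrite opprK addrC.
rewrite mul1r -mulrDr -big_split mulr_sumr; apply: eq_bigr => j _ /=.
rewrite /singular_part (omega_sgn_right j hf yr) eqxx mul1r.
by rewrite mulrCA -mulrDl.
Qed.

(** After exchanging the sums, the jumps at [y >= x] add up to $f(r)-f_{x^-}(r)$ and those at
    [y < x] to $f_{x^-}(-r)-f(-r)$. As 0 occurs exactly once in [s], its correction enters once. *)
Lemma sum_singular_part (R : realType) (n : nat) (r : R) (f : R -> R)
    (s : seq R) (x : R) :
  tropical_meromorphic n r f ->
  uniq s -> 0 \in s -> (forall y, y \in s -> - r < y < r) ->
  f r = (left_poly f x).[r] + \sum_(y <- s | x <= y) (jump f y).[r] ->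
  f (- r) =
    (left_poly f x).[- r] - \sum_(y <- s | y < x) (jump f y).[- r] ->
  \sum_(1 <= j < n.+1) \sum_(y <- s) singular_part n r f x j y =
  (r + x) ^+ n * (f r - (left_poly f x).[r])
  + (r - x) ^+ n * (f (- r) - (left_poly f x).[- r])
  + far_weight n r x 0
    * ((left_poly f 0).[r] + (left_poly f 0).[- r] - 2 * f 0).
Proof.
move=> hf us s0 sr fr fNr; rewrite exchange_big/=.
rewrite (eq_big_seq _ (fun y ys => sum_singular_part_at x hf (sr y ys))).
rewrite big_split/=; congr (_ + _); last first.
  rewrite (bigD1_seq 0)//= eqxx mul1r big1 ?addr0// => y /negbTE->.
  by rewrite mul0r.
rewrite fr fNr [X in X - _]addrC addrK [X in _ * (X - _)]addrC addrK.
rewrite !mulr_sumr mulrN mulr_sumr -sumrN.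
rewrite (bigID (fun y => x <= y))/=; congr (_ + _).
  by apply: eq_bigr => y; rewrite /far_weight /far_end => ->.
apply: eq_big => y; first by rewrite ltNge.
by rewrite /far_weight /far_end => /negbTE ->; rewrite mulNr.
Qed.

Lemma omega_off_jumps (R : realType) (n : nat) (r : R) (f : R -> R) (j : nat)
    (y : R) :
  tropical_meromorphic n r f -> - r < y < r -> y != 0 -> jump f y = 0 ->
  omega f j y = 0.
Proof.
move=> hf yr y0 jy; have := omega_sgn_right j hf yr.
rewrite jy linear0 horner0 (negbTE y0) mul0r addr0 => /eqP.
rewrite mulf_eq0 expf_eq0 /sgn_right (negbTE y0) sgr_eq0 (negbTE y0) orbF.
by move/eqP.
Qed.

(** * Sums over singularities as sums over a finite list *)

(** Every singularity lies in [s], and a point of [s] that is not one has [omega f j y = 0], hence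
    [g y = 0]. With membership in [F] as a coefficient, sums over different sectors can be added
    termwise. *)
Lemma singsumE (R : realType) (n : nat) (r : R) (f : R -> R) (s : seq R)
    (F : set R) (j : nat) (g : R -> R) :
  uniq s -> (forall y, y \in s -> - r < y < r) ->
  (forall j y, - r < y < r -> y \notin s -> omega f j y = 0) ->
  (1 <= j <= n)%N -> (forall y, omega f j y = 0 -> g y = 0) ->
  singsum n r f F g = \sum_(y <- s) (y \in F)%:R * g y.
Proof.
move=> us sr s0 jn g0; rewrite fsbig_seq// /singsum.
rewrite (eq_fsbigr (fun y => (y \in F)%:R * g y)); last first.
  by move=> y; rewrite in_setI => /andP[_ ->]; rewrite mul1r.
apply: fsbig_widen.
  move=> y [[yr [i [_ wi]]] _] /=; apply/negPn/negP => /(s0 i _ yr) w0.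
  by move: wi; rewrite /is_root /is_pole w0 ltxx => -[].
move=> y [/= ys /not_andP[nS|nF]]; last by rewrite memNset// mul0r.
rewrite g0 ?mulr0//; apply/eqP/negPn/negP => w; apply: nS.
split; first exact: sr.
by exists j; split=> //; apply/orP; rewrite /is_root /is_pole orbC -neq_lt.
Qed.

(** The absolute value of [omega] is [omega] at roots and its negative at poles, so the difference
    is one signed sum. *)
Lemma sum_root_pole (R : realType) (r : R) (f : R -> R) (s : seq R) (j : nat)
    (g : R -> R) :
  uniq s -> (forall y, y \in s -> - r < y < r) ->
  (forall y, - r < y < r -> y \notin s -> omega f j y = 0) ->
  \sum_(y \in [set y : R | is_root f j y /\ `|y| < r]) (`|omega f j y| * g y)
  - \sum_(y \in [set y : R | is_pole f j y /\ `|y| < r]) (`|omega f j y| * g y)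
  = \sum_(y <- s) omega f j y * g y.
Proof.
move=> us sr s0.
have widen (P : set R) : (forall y, P y -> omega f j y != 0) ->
    \sum_(y \in [set y : R | P y /\ `|y| < r]) (`|omega f j y| * g y) =
    \sum_(y <- s) (y \in P)%:R * (`|omega f j y| * g y).
  move=> P0; rewrite [RHS]fsbig_seq//.
  rewrite (eq_fsbigr (fun y => (y \in P)%:R * (`|omega f j y| * g y)));
    last first.
    by move=> y /set_mem[Py _]; rewrite mem_set// mul1r.
  apply: fsbig_widen => [y /= [Py]|y [/= ys /not_andP[nP|]]].
  - rewrite ltr_norml => yr; apply/negPn/negP => /(s0 _ yr) w0.
    by have := P0 _ Py; rewrite w0 eqxx.
  - by rewrite memNset// mul0r.
  - by rewrite ltr_norml sr.
rewrite (widen (is_root f j)) ?(widen (is_pole f j)); last 2 first.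

- by move=> y; exact: ltr0_neq0.
- by move=> y; exact: lt0r_neq0.
rewrite -sumrB; apply: eq_bigr => y _.
have -> : (y \in (is_root f j : set R)) = (0 < omega f j y).
  by apply/idP/idP => [/set_mem|/mem_set].
have -> : (y \in (is_pole f j : set R)) = (omega f j y < 0).
  by apply/idP/idP => [/set_mem|/mem_set].
by case: (ltgtP (omega f j y) 0) => w /=;
  rewrite ?(ltr0_norm w) ?(gtr0_norm w) ?w; ring.
Qed.

(** * The sectors and their coefficients *)

Lemma in_Fs (R : realType) (r x y : R) :
  ((y \in Defs.F1 r x) = [&& - r < y, y < 0 & y < x]) *
  ((y \in Defs.F2 r x) = [&& 0 < y, x < y & y < r]) *
  ((y \in Defs.F3 x) = (y == x) && (x == 0)) *
  ((y \in Defs.F4 x) = (0 < y < x)) *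
  ((y \in Defs.F5 x) = (x < y < 0)) *
  ((y \in Defs.F6 x) = (x < y) && (y == 0)) *
  ((y \in Defs.F7 x) = (y == 0) && (0 < x)) *
  ((y \in Defs.F8 x) = (0 < y) && (y == x)) *
  ((y \in Defs.F9 x) = (y == x) && (x < 0)).
Proof.
have eqb (A : set R) (b : bool) : (A y <-> b) -> (y \in A) = b.
  by move=> Ab; apply/idP/idP => [/set_mem/Ab|/Ab/mem_set].
rewrite /Defs.F1 /Defs.F2 /Defs.F3 /Defs.F4 /Defs.F5 /Defs.F6 /Defs.F7 /Defs.F8.
rewrite /Defs.F9; do !split; apply: eqb => /=.
- by rewrite lt_min.
- by rewrite gt_max -andbA.
- by split=> [[-> ->]|/andP[/eqP-> /eqP->]]; rewrite ?eqxx.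
- by [].
- by [].
- by split=> [[-> ->]|/andP[-> /eqP->]]; rewrite ?eqxx.
- by split=> [[-> ->]|/andP[/eqP-> ->]]; rewrite ?eqxx.
- by split=> [[-> ->]|/andP[-> /eqP->]]; rewrite ?eqxx.
- by split=> [[-> ->]|/andP[/eqP-> ->]]; rewrite ?eqxx.
Qed.

(* The coefficients of B and D, read off from the position of y relative to 0
   and x, recombine to a single power of r + x or r - x. *)
Lemma sector_weights (R : realType) (n j : nat) (r x y : R) :
  (j <= n)%N -> - r < x < r -> - r < y < r ->
  let wB := (y \in Defs.F1 r x `|` Defs.F2 r x `|` Defs.F3 x `|` Defs.F6 x
                   `|` Defs.F8 x)%:R
            + (-1) ^+ j.+1 * (y \in Defs.F4 x `|` Defs.F5 x `|` Defs.F7 x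
                                    `|` Defs.F9 x)%:R in
  let wD := - (y \in Defs.F1 r x)%:R
            + (y \in Defs.F2 r x `|` Defs.F6 x `|` Defs.F8 x)%:R
            + (-1) ^+ j * (y \in Defs.F4 x `|` Defs.F7 x)%:R
            + (-1) ^+ j.+1 * (y \in Defs.F5 x `|` Defs.F9 x)%:R in
  E r x y ^+ j * (wB * B (n - j) r x + wD * D (n - j) r x) =
  sgn_right y ^+ j.+1 * (far_weight n r x y * (far_end r x y - y) ^+ j).
Proof.
move=> jn /andP[rx xr] /andP[ry yr] /=.
have BD k : B k r x + D k r x = (r + x) ^+ k by rewrite /B /D; field.
have BND k : B k r x - D k r x = (r - x) ^+ k by rewrite /B /D; field.
have D0 : x = 0 -> D (n - j) r x = 0.
  by move=> ->; rewrite /D addr0 subr0 subrr mul0r.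
have EE : E r x y = if x <= y then (r + x) * (r - y) else (r - x) * (r + y).
  rewrite /E; case: (leP x y) => xy.
    by rewrite distrC ger0_norm ?subr_ge0//; ring.
  by rewrite gtr0_norm ?subr_gt0//; ring.
have Nl : (- r - y) ^+ j = (-1) ^+ j * (r + y) ^+ j.
  by rewrite -exprMn; congr (_ ^+ _); ring.
have Pn : (r + x) ^+ n = (r + x) ^+ j * (r + x) ^+ (n - j).
  by rewrite -exprD subnKC.
have Mn : (r - x) ^+ n = (r - x) ^+ j * (r - x) ^+ (n - j).
  by rewrite -exprD subnKC.
have sgE : sgn_right y ^+ j.+1 = if y < 0 then - (-1) ^+ j else 1.
  rewrite /sgn_right; case: (ltgtP y 0) => [y0|y0|_]; last by rewrite expr1n.
    by rewrite ltr0_sg// exprS mulN1r.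
  by rewrite gtr0_sg// expr1n.
have sgj : (-1) ^+ j = 1 :> R \/ (-1) ^+ j = -1 :> R.
  by rewrite -signr_odd; case: (odd j); [right|left].
rewrite /far_weight /far_end !in_setU !(in_Fs r x y) ry yr sgE EE.
rewrite [(-1) ^+ j.+1]exprS.
(* Only the fact that this power is 1 or -1 matters below. *)
move: ((-1) ^+ j) sgj Nl => e sgj Nl; rewrite Pn Mn.
have [x0|x0|x0] := ltgtP x 0; have [y0|y0|y0] := ltgtP y 0;
  have [xy|xy|xy] := ltgtP x y.
all: try (exfalso; lra).
all: rewrite /= exprMn ?Nl.
all: rewrite -?BD -?BND.
all: try (by ring).
(* This is [x = y = 0], the sector [F3], which is absent from the coefficient of [D];
   $D_{n-j}(r,0)=0$ makes up for it. *)
4: by rewrite D0 //; ring.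
(* The rest lies in [F1]: the sign of [y] and that of [- r - y] each bring a factor $(-1)^j$, and
   the two cancel. *)
all: by case: sgj => ->; ring.
Qed.

(** * Assembly of the formula and the case of the origin *)

Theorem theorem3p3 (R : realType) (n : nat) (hn : (0 < n)%N) (r : R)
    (hr : 0 < r) (f : R -> R) (hf : tropical_meromorphic n r f) :
  (forall x : R, - r < x < r ->
    let F1 := Defs.F1 r x in let F2 := Defs.F2 r x in
    let F3 := Defs.F3 x in let F4 := Defs.F4 x in
    let F5 := Defs.F5 x in let F6 := Defs.F6 x in
    let F7 := Defs.F7 x in let F8 := Defs.F8 x in
    let F9 := Defs.F9 x in
    let termB := fun (j : nat) (y : R) =>
      omega f j y * E r x y ^+ j * (B (n - j) r x / (2 * B n r x)) in
    let termD := fun (j : nat) (y : R) =>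
      omega f j y * E r x y ^+ j * (D (n - j) r x / (2 * B n r x)) in
    f x =
      (f r + f (- r)) / 2 + D n r x / (2 * B n r x) * (f r - f (- r))
      - \sum_(1 <= j < n.+1)
          (singsum n r f (F1 `|` F2 `|` F3 `|` F6 `|` F8) (termB j)
           + (-1) ^+ j.+1
             * singsum n r f (F4 `|` F5 `|` F7 `|` F9) (termB j))
      - \sum_(1 <= j < n.+1)
          (- singsum n r f F1 (termD j)
           + singsum n r f (F2 `|` F6 `|` F8) (termD j)
           + (-1) ^+ j * singsum n r f (F4 `|` F7) (termD j)
           + (-1) ^+ j.+1 * singsum n r f (F5 `|` F9) (termD j))
      - ((r + x) ^+ n / (2 * B n r x) * ((left_poly f x).[r] - f x)
         + (r - x) ^+ n / (2 * B n r x) * ((left_poly f x).[- r] - f x))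
      - sgn_left x * ((r - `|x|) ^+ n / (2 * B n r x))
        * ((left_poly f 0).[r] + (left_poly f 0).[- r] - 2 * f 0))
  /\
  f 0 =
    (f r + f (- r)) / 2
    - 2^-1 * \sum_(1 <= j < n.+1)
        \sum_(y \in [set y : R | is_root f j y /\ `|y| < r])
          (`|omega f j y| * (r - `|y|) ^+ j)
    + 2^-1 * \sum_(1 <= j < n.+1)
        \sum_(z \in [set z : R | is_pole f j z /\ `|z| < r])
          (`|omega f j z| * (r - `|z|) ^+ j).
Proof.
have [s [us s0 sr js fs]] := tropical_jumps0 hr hf.
have w0 j y : - r < y < r -> y \notin s -> omega f j y = 0.
  move=> yr ys; apply: (omega_off_jumps j hf yr _ (js _ yr ys)).
  by apply: contraNneq ys => ->.
have core x : - r < x < r -> _ := fun xr =>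
  sum_singular_part hf us s0 sr (fs x xr).1 (fs x xr).2.
split=> [x xr|].
- move=> F1 F2 F3 F4 F5 F6 F7 F8 F9 termB termD.
  have [rx0 xr0] : 0 < r + x /\ 0 < r - x by move: xr => /andP[? ?]; split; lra.
  have BP : 2 * B n r x = (r + x) ^+ n + (r - x) ^+ n by rewrite /B; field.
  have B0 : 2 * B n r x != 0.
    by rewrite BP gt_eqF// addr_gt0// exprn_gt0.
  pose c := (2 * B n r x)^-1.
  have sumE F j (g : R -> R) : (1 <= j < n.+1)%N ->
      singsum n r f F (fun y => omega f j y * E r x y ^+ j * g y) =
      \sum_(y <- s) (y \in F)%:R * (omega f j y * E r x y ^+ j * g y).
    by move=> jn; rewrite (singsumE _ us sr w0 jn)// => y ->; rewrite !mul0r.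
  set S1 := \sum_(1 <= j < n.+1) _; set S2 := \sum_(1 <= j < n.+1) _.
  (* Only the [B] and [D] sums together reduce to powers of [r + x] or [r - x], so they are treated
     as one. *)
  have S12 : S1 + S2 =
      c * \sum_(1 <= j < n.+1) \sum_(y <- s) singular_part n r f x j y.
    rewrite /S1 /S2 -big_split mulr_sumr /=; apply: eq_big_nat => j jn.
    rewrite /termB /termD !(sumE _ j (fun=> _) jn).
    rewrite !mulr_sumr -sumrN -!big_split /=; apply: eq_big_seq => y ys.
    have jn' : (j <= n)%N by case/andP: jn.
    rewrite [singular_part _ _ _ _ _ _]/singular_part -[X in c * X]mulrA.
    rewrite -(sector_weights jn' xr (sr y ys)) -/c.
    by rewrite /F1 /F2 /F3 /F4 /F5 /F6 /F7 /F8 /F9; ring.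
  (* The convention [sgn_left 0 = -1] matches [far_weight], which counts [y = 0] as right of
     [x = 0]. *)
  have fwK : far_weight n r x 0 = - (sgn_left x * (r - `|x|) ^+ n).
    rewrite /far_weight /sgn_left; case: (ltgtP x 0) => [x0|x0|->].
    - by rewrite ltr0_sg// ltr0_norm// opprK mulN1r opprK.
    - by rewrite gtr0_sg// gtr0_norm// mul1r.
    - by rewrite normr0 addr0 subr0 mulN1r opprK.
  have -> : S1 =
      c * \sum_(1 <= j < n.+1) \sum_(y <- s) singular_part n r f x j y - S2
    by rewrite -S12 addrK.
  by rewrite (core _ xr) fwK /c BP /D; move: B0; rewrite BP => B0; field.
- have r0 : - r < 0 < r by rewrite oppr_lt0 hr.
  set SR := \sum_(1 <= j < n.+1) _; set SP := \sum_(1 <= j < n.+1) _.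
  suff : SR - SP = f r + f (- r) - 2 * f 0 by lra.
  have rn0 : r ^+ n != 0 by rewrite expf_neq0// gt_eqF.
  (* At [x = 0] all three weights equal $r^n$, and the values of $f_{0^-}$ at [r] and [- r]
     cancel. *)
  apply: (mulfI rn0); transitivity
      (\sum_(1 <= j < n.+1) \sum_(y <- s) singular_part n r f 0 j y);
    last first.
    by rewrite (core _ r0) /far_weight lexx addr0 subr0; ring.
  rewrite /SR /SP -sumrB mulr_sumr; apply: eq_bigr => j _.
  rewrite (sum_root_pole (fun y => (r - `|y|) ^+ j) us sr (w0 j)) mulr_sumr.
  apply: eq_bigr => y _.
  rewrite /singular_part /far_weight /far_end addr0 subr0 /sgn_right.
  case: (ltgtP 0 y) => [y0|y0|<-].
  - by rewrite gtr0_sg// gtr0_norm// expr1n; ring.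
  (* For [y < 0] the signs from $\operatorname{sgn}^{j+1}$, from the weight $-r^n$ and from
     $(-r-y)^j$ multiply to 1. *)
  - rewrite ltr0_sg// ltr0_norm// opprK -opprD -[- (r + y)]mulN1r.
    by rewrite exprMn exprS -signr_odd; case: (odd j) => /=; ring.
  - by rewrite normr0 expr1n; ring.
Qed.
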